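(* For every prime $N$ and every integer $m\ge2$ one has $S(m,N)\ge S^{\mathbb{Z}}(m,N)$.
   Context: Let $N$ be prime, $m\ge2$, $\mathbb{Z}_N=\mathbb{Z}/N\mathbb{Z}$ with elements identified with $0,\dots,N-1$. A hyperplane in $\mathbb{Z}_N^m$ is a set $H=\{x:h\cdot x=0\}$ for a nonzero normal $h\in\mathbb{Z}_N^m$. Let $n(H)$ be the minimum, over all normals $h$ defining $H$, of the integer $\sum_{i=1}^m h_i$ (sum of representatives in $\{0,\dots,N-1\}$). Index all hyperplanes of $\mathbb{Z}_N^m$ as $H_1,H_2,\dots$ so that $n(H_1)\le n(H_2)\le\cdots$ and put $S(m,N)=\sum_{i=1}^{N+1}n(H_i)$, the sum of the $N+1$ smallest values of $n$ (there are at least $N+1$ hyperplanes). Let $c_i(m)$ be the number of $(x_1,\dots,x_m)\in\mathbb{Z}_{\ge0}^m$ with $\sum_j x_j=i$ and $\gcd(x_1,\dots,x_m)=1$. Let $k=k^{\mathbb{Z}}_{m,N}=\min\{k\ge0:\sum_{i=1}^{k+1}c_i(m)>N+1\}$ and $$S^{\mathbb{Z}}(m,N)=\sum_{i=1}^{k}i\,c_i(m)+\Bigl(N+1-\sum_{i=1}^{k}c_i(m)\Bigr)(k+1).$$ *)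

(* Defs.v *)
From mathcomp Require Import all_boot all_order all_algebra.

Set Implicit Arguments.
Unset Strict Implicit.
Unset Printing Implicit Defensive.

Import Order.TTheory GRing.Theory.

Section ModularHyperplanes.

Variables m N : nat.

(* For N prime, 'F_N is Z/NZ, and its elements are the ordinals 0, .., N - 1. *)
Definition hyperplane (h : 'rV['F_N]_m) : {set 'rV['F_N]_m} :=
  [set x : 'rV['F_N]_m | (\sum_(i < m) h ord0 i * x ord0 i == 0)%R].

Definition is_normal (H : {set 'rV['F_N]_m}) (h : 'rV['F_N]_m) : bool :=
  (h != 0%R) && (H == hyperplane h).

Definition hyperplanes : {set {set 'rV['F_N]_m}} :=
  [set H : {set 'rV['F_N]_m} | [exists h, is_normal H h]].

Definition weight (h : 'rV['F_N]_m) : nat :=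
  \sum_(i < m) nat_of_ord (h ord0 i).

(* The starting value [\sum_h weight h] of the iterated minimum is at least
   every weight, so it does not affect the result when [H] has a normal;
   see [hyperplane_weightP]. *)
Definition hyperplane_weight (H : {set 'rV['F_N]_m}) : nat :=
  \big[Order.min/ \sum_(h : 'rV['F_N]_m) weight h]_(h | is_normal H h) weight h.

Definition S_mod : nat :=
  sumn (take N.+1 (sort leq [seq hyperplane_weight H | H in hyperplanes])).

Lemma hyperplane_weightP (H : {set 'rV['F_N]_m}) : H \in hyperplanes ->
  (exists2 h, is_normal H h & hyperplane_weight H = weight h) /\
  (forall h, is_normal H h -> hyperplane_weight H <= weight h).
Proof.
rewrite inE => /existsP[h0 h0P].
have wle h : weight h <= \sum_(h : 'rV['F_N]_m) weight h.
  by rewrite (bigD1 h) //= leq_addr.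
split; last by move=> h hP; rewrite -leEnat; exact: bigmin_le_cond.
rewrite /hyperplane_weight (bigmin_eq_arg _ h0 _ _ h0P) => [|h _]; last first.
  by rewrite leEnat.
by case: arg_minP => // h hP _; exists h.
Qed.

End ModularHyperplanes.

Section PrimitivePoints.

Variable m : nat.

(* The coordinates of a point of N^m with coordinate sum [i] are at most [i]. *)
Definition primitive_count (i : nat) : nat :=
  #|[set x : {ffun 'I_m -> 'I_i.+1} |
      (\sum_(j < m) x j == i)%N && (\big[gcdn/0]_(j < m) x j == 1)]|.

Hypothesis m_gt1 : 1 < m.

Lemma primitive_count_gt0 i : 0 < i -> 0 < primitive_count i.
Proof.
move=> i_gt0; apply/card_gt0P.
pose j0 := Ordinal (ltnW m_gt1); pose j1 := Ordinal m_gt1.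
pose f (j : 'I_m) := if j == j0 then 1 else if j == j1 then i.-1 else 0.
have f_le j : f j < i.+1.
  by rewrite /f; case: eqP => // _; case: eqP; rewrite ?ltnS ?leq_pred.
exists [ffun j => Ordinal (f_le j)]; rewrite inE; apply/andP; split.
  rewrite (eq_bigr f) => [|j _]; last by rewrite ffunE.
  rewrite (bigD1 j0) //= (bigD1 j1) //= big1 /f; last first.
    by move=> j /andP[/negPf-> /negPf->].
  by rewrite addn0 /= add1n prednK.
rewrite (eq_bigr f) => [|j _]; last by rewrite ffunE.
by rewrite (bigD1 j0) //= /f eqxx gcd1n.
Qed.

Lemma primitive_count_unbounded M :
  exists k, M < \sum_(1 <= i < k.+2) primitive_count i.
Proof.
exists M; apply: (@leq_trans (\sum_(1 <= i < M.+2) 1)).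
  by rewrite sum_nat_const_nat muln1 subn1.
rewrite [leqLHS]big_nat [leqRHS]big_nat.
by apply: leq_sum => i /andP[i_gt0 _]; exact: primitive_count_gt0.
Qed.

Definition kZ (N : nat) : nat := ex_minn (primitive_count_unbounded N.+1).

Lemma sum_primitive_count_kZ N :
  \sum_(1 <= i < (kZ N).+1) primitive_count i <= N.+1.
Proof.
rewrite /kZ; case: ex_minnP => -[|k] _ kmin; first by rewrite big_geq.
by rewrite leqNgt; apply/negP => /kmin; rewrite ltnn.
Qed.

(* The subtraction never truncates, by [sum_primitive_count_kZ]. *)
Definition S_int (N : nat) : nat :=
  \sum_(1 <= i < (kZ N).+1) i * primitive_count i
  + (N.+1 - \sum_(1 <= i < (kZ N).+1) primitive_count i) * (kZ N).+1.

End PrimitivePoints.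

(* Main.v *)
(** A minimal normal [h] of a hyperplane has coprime coordinates: a common
    divisor [d > 1] is smaller than [N], hence a unit mod [N], and [h / d] would
    be a smaller normal of the same hyperplane.  So at most [c_i(m)] hyperplanes
    have [n(H) = i].  Any [N + 1] naturals with these multiplicity bounds have
    sum at least [(N + 1) K - \sum_(i < K) (K - i) c_i(m)] for every [K], since
    [K <= x + (K - x)] with truncated subtraction; [K = k + 1] gives the bound. *)
Require Import Defs.
From mathcomp Require Import all_boot all_order all_algebra.
From mathcomp Require Import zify.

Set Implicit Arguments.
Unset Strict Implicit.
Unset Printing Implicit Defensive.

Import GRing.Theory.

Lemma sum_seq_count (F : nat -> nat) (K : nat) (s : seq nat) :
  (forall x, K <= x -> F x = 0) ->
  \sum_(x <- s) F x = \sum_(i < K) F i * count_mem (i : nat) s.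
Proof.
move=> F0; elim: s => [|x s IHs].
  by rewrite big_nil big1 // => i _; rewrite muln0.
rewrite big_cons IHs.
under [RHS]eq_bigr => i _ do rewrite /= mulnDr.
rewrite big_split /=; congr (_ + _).
have [Kx|xK] := leqP K x.
  rewrite F0 // big1 // => i _; case: eqP => [xi|]; last by rewrite muln0.
  by move: (ltn_ord i); rewrite -xi ltnNge Kx.
rewrite (bigD1 (Ordinal xK)) //= eqxx muln1 big1 ?addn0 // => i /eqP xi.
by case: eqP => [e|]; rewrite ?muln0 //; case: xi; apply: val_inj.
Qed.

Lemma sumn_ge_count (c : nat -> nat) (K : nat) (s : seq nat) :
  (forall i, count_mem i s <= c i) ->
  size s * K <= sumn s + \sum_(i < K) (K - i) * c i.
Proof.
move=> sc.
apply: (@leq_trans (sumn s + \sum_(x <- s) (K - x))); last first.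
  rewrite leq_add2l (@sum_seq_count (fun x => K - x) K).
    by apply: leq_sum => i _; rewrite leq_mul2l sc orbT.
  by move=> x; rewrite -subn_eq0 => /eqP.
rewrite sumnE -big_split /= -sum1_size big_distrl /=.
by apply: leq_sum => x _; rewrite mul1n -leq_subLR.
Qed.

Lemma count_image (T : finType) (A : {set T}) (f : T -> nat) i :
  count_mem i [seq f x | x in A] = #|[set x in A | f x == i]|.
Proof.
rewrite count_map -size_filter cardE; congr size.
rewrite /enum_mem -filter_predI; apply: eq_filter => x.
by rewrite /= !inE andbC.
Qed.

Lemma primitive_count0 m : primitive_count m 0 = 0.
Proof.
apply: eq_card0 => x; rewrite !inE; apply/negP => /andP[_ /eqP].
by rewrite big1 // => j _; case: (x j) => -[].
Qed.

Lemma S_intE m (m_gt1 : 1 < m) N :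
  S_int m_gt1 N + \sum_(i < (kZ m_gt1 N).+1)
     ((kZ m_gt1 N).+1 - i) * primitive_count m i = N.+1 * (kZ m_gt1 N).+1.
Proof.
rewrite -(big_mkord xpredT (fun i => (_ - i) * primitive_count m i)).
rewrite big_ltn // primitive_count0 muln0 add0n /S_int addnAC -big_split /=.
under eq_big_nat => i /andP[_ iK] do rewrite -mulnDl subnKC 1?ltnW //.
rewrite -big_distrr /= mulnC -mulnDl subnKC //.
exact: sum_primitive_count_kZ.
Qed.

Section Hyperplanes.

Variables m N : nat.
Hypothesis N_prime : prime N.
Implicit Types (h : 'rV['F_N]_m) (H : {set 'rV['F_N]_m}).

Lemma hyperplaneZ (a : 'F_N) h : a != 0%R -> hyperplane (a *: h)%R = hyperplane h.
Proof.
move=> a0; apply/setP => x; rewrite !inE.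
under eq_bigr => i _ do rewrite mxE -mulrA.
by rewrite -big_distrr /= mulf_eq0 (negPf a0).
Qed.

Lemma minimal_normal_primitive h :
  h != 0%R ->
  (forall g, g != 0%R -> hyperplane g = hyperplane h -> weight h <= weight g) ->
  \big[gcdn/0]_(j < m) (h ord0 j : nat) = 1.
Proof.
move=> h0 hmin; set d := \big[gcdn/0]_(j < m) _.
have ltN (a : 'F_N) : a < N by move: (ltn_ord a); rewrite [X in _ < X]Fp_cast.
have dvd_d j : d %| h ord0 j by rewrite /d (bigD1 j) //= dvdn_gcdl.
have [j hj] : exists j, h ord0 j != 0%R by exact/rV0Pn.
have hj_gt0 : 0 < h ord0 j by rewrite lt0n.
have d_gt0 : 0 < d := dvdn_gt0 hj_gt0 (dvd_d j).
have dN : d < N := leq_ltn_trans (dvdn_leq hj_gt0 (dvd_d j)) (ltN _).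
have d0 : (d%:R : 'F_N)%R != 0%R.
  by rewrite -val_eqE /= val_Fp_nat // modn_small // -lt0n.
pose g : 'rV['F_N]_m := (\row_i (h ord0 i %/ d)%:R)%R.
have gE i : g ord0 i = h ord0 i %/ d :> nat.
  rewrite mxE val_Fp_nat // modn_small //.
  exact: leq_ltn_trans (leq_div _ _) (ltN _).
have hE : h = (d%:R *: g)%R.
  apply/rowP => i; rewrite !mxE -natrM mulnC divnK //.
  by rewrite natr_Zp.
have g0 : g != 0%R by apply: contraNneq h0 => g0; rewrite hE g0 scaler0.
have wE : weight h = weight g * d.
  rewrite /weight big_distrl /=; apply: eq_bigr => i _.
  by rewrite gE divnK.
have := hmin g g0; rewrite {1}hE hyperplaneZ // => /(_ erefl).
rewrite wE; have : 0 < weight h.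
  by rewrite /weight (bigD1 j) //= ltn_addr.
by rewrite wE muln_gt0 => /andP[? _]; nia.
Qed.

Lemma card_hyperplane_weight i :
  #|[set H in @hyperplanes m N | hyperplane_weight H == i]| <= primitive_count m i.
Proof.
pose nrm H := odflt 0%R [pick h | is_normal H h && (hyperplane_weight H == weight h)].
have nrmP H : H \in @hyperplanes m N ->
    is_normal H (nrm H) /\ hyperplane_weight H = weight (nrm H).
  move=> /hyperplane_weightP[[h hN hw] _]; rewrite /nrm.
  case: pickP => [g /andP[? /eqP]//|/(_ h)].
  by rewrite hN hw eqxx.
pose f H : {ffun 'I_m -> 'I_i.+1} := [ffun j => inord (nrm H ord0 j)].
have fE H j : H \in [set H in @hyperplanes m N | hyperplane_weight H == i] ->
    f H j = nrm H ord0 j :> nat.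
  move=> /setIdP[/nrmP[_ wE] /eqP wi].
  by rewrite ffunE inordK // ltnS -wi wE /weight (bigD1 j) //= leq_addr.
rewrite -(card_in_imset (f := f)).
  apply/subset_leq_card/subsetP => _ /imsetP[H HA ->]; rewrite inE.
  under eq_bigr => j _ do rewrite (fE _ _ HA).
  under [X in _ && (X == _)]eq_bigr => j _ do rewrite (fE _ _ HA).
  have [Hh /eqP Hi] := setIdP HA.
  have [/andP[n0 /eqP HE] wE] := nrmP H Hh.
  rewrite -/(weight (nrm H)) -wE Hi eqxx /=.
  apply/eqP; apply: minimal_normal_primitive => // g g0 gE.
  rewrite -wE; apply: (proj2 (hyperplane_weightP Hh)).
  by rewrite /is_normal g0 gE -HE eqxx.
move=> H H' HA HA' ff.
have nE : nrm H = nrm H'.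
  by apply/rowP => j; apply: val_inj; rewrite /= -!fE // ff.
have [[Hh _] [Hh' _]] := (setIdP HA, setIdP HA').
have [/andP[_ /eqP->] _] := nrmP H Hh; have [/andP[_ /eqP->] _] := nrmP H' Hh'.
by rewrite nE.
Qed.

Lemma card_hyperplanes_gt : 1 < m -> N < #|@hyperplanes m N|.
Proof.
move=> m_gt1.
pose j0 := Ordinal (ltnW m_gt1); pose j1 := Ordinal m_gt1.
pose pt (a b : 'F_N) : 'rV['F_N]_m :=
  (\row_j if j == j0 then a else if j == j1 then b else 0)%R.
have ptE a b c d : (pt c d \in hyperplane (pt a b)) = (a * c + b * d == 0)%R.
  rewrite inE (bigD1 j0) //= (bigD1 j1) //= big1 ?addr0 ?mxE //.
  by move=> j /andP[/negPf j0F /negPf j1F]; rewrite !mxE j0F j1F mul0r.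
pose f (o : option 'F_N) :=
  hyperplane (if o is Some t then pt 1%R t else pt 0%R 1%R).
have f_inj : injective f.
  have mem o t : (pt (- t)%R 1%R \in f o) = (o == Some t).
    case: o => [s|]; rewrite ptE.
      by rewrite mul1r mulr1 addrC subr_eq0.
    by rewrite mul0r mul1r add0r oner_eq0.
  move=> [s|] [t|] // E.
  - by have := mem (Some s) s; rewrite E mem eqxx => /eqP.
  - by have := mem (Some s) s; rewrite E mem eqxx.
  - by have := mem (Some t) t; rewrite -E mem eqxx.
have := card_codom f_inj; rewrite card_option card_Fp // => <-.
apply/subset_leq_card/subsetP => _ /codomP[o ->]; rewrite inE.
apply/existsP; exists (if o is Some t then pt 1%R t else pt 0%R 1%R).
rewrite /is_normal eqxx andbT; apply/rV0Pn.
by case: o => [t|]; [exists j0 | exists j1]; rewrite mxE.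
Qed.

End Hyperplanes.

Theorem lemma2p19 (m N : nat) (m_gt1 : 1 < m) (N_prime : prime N) :
  S_int m_gt1 N <= S_mod m N.
Proof.
rewrite -(leq_add2r (\sum_(i < (kZ m_gt1 N).+1)
  ((kZ m_gt1 N).+1 - i) * primitive_count m i)) S_intE /S_mod.
set s := sort _ _.
have sz : size (take N.+1 s) = N.+1.
  by rewrite size_takel // size_sort size_map -cardE card_hyperplanes_gt.
rewrite -[X in X * _]sz; apply: sumn_ge_count => i.
apply: leq_trans (card_hyperplane_weight m N_prime i).
have -> : #|[set H in @hyperplanes m N | hyperplane_weight H == i]|
    = count_mem i s by rewrite -count_image; apply/esym/permP; rewrite perm_sort.
rewrite -[in leqRHS](cat_take_drop N.+1 s).
by rewrite count_cat leq_addr.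
Qed.
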